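(* Let $n\geq 1$, let $\beta=(\beta_1,\dots,\beta_n)$ be a sequence of non-negative integers (a Betti curve of length $n$), and let $\mu=\sum_{i=1}^{n}\beta_i\alpha_i$ be the corresponding weight of the Lie algebra of type $A_n$, where $\alpha_i=\mathbf{e}_i-\mathbf{e}_{i+1}$ are the simple roots. Then $$|\mathbf{Barc}(\beta)| = K(\mu),$$ where $\mathbf{Barc}(\beta)$ is the set of barcodes in $[n]$ with Betti curve $\beta$ and $K$ is the Kostant partition function of type $A_n$.
   Context: Write $[n]=\{1,\dots,n\}$. For integers $i\le j$, $[i,j)$ denotes $\{i,i+1,\dots,j-1\}$; nonempty sets of this form are called intervals. The intervals contained in $[n]$ are thus the sets $[i,j)$ with $1\le i<j\le n+1$. A Betti curve of length $n$ is a function $\beta\colon[n]\to\mathbb{Z}_{\ge 0}$, written $(\beta_1,\dots,\beta_n)$ with $\beta_i=\beta(i)$. A barcode is a (finite) multiset of intervals; $\mathbf{Barc}(n)$ is the set of barcodes all of whose intervals are subsets of $[n]$. The Betti curve $\varphi(B)$ of $B\in\mathbf{Barc}(n)$ is the function sending $i\in[n]$ to the number of intervals of $B$, counted with multiplicity, that contain $i$. For a Betti curve $\beta$ of length $n$, $\mathbf{Barc}(\beta)=\varphi^{-1}(\beta)=\{B\in\mathbf{Barc}(n):\varphi(B)=\beta\}$. Let $\mathbf{e}_1,\dots,\mathbf{e}_{n+1}$ be the standard basis of $\mathbb{R}^{n+1}$. The positive roots of type $A_n$ are the vectors $\mathbf{e}_i-\mathbf{e}_j$ with $1\le i<j\le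 n+1$; the simple roots are $\alpha_i=\mathbf{e}_i-\mathbf{e}_{i+1}$, $1\le i\le n$. Here a weight means an element $\mu\in\mathbb{R}^{n+1}$ of the form $\mu=\sum_{i=1}^n z_i\alpha_i$ with $z_i\in\mathbb{Z}_{\ge0}$. The Kostant partition function $K(\mu)$ is the number of ways to write $\mu$ as a non-negative integral linear combination of positive roots, i.e. the number of families $(c_{ij})_{1\le i<j\le n+1}$ of non-negative integers with $\sum_{i<j}c_{ij}(\mathbf{e}_i-\mathbf{e}_j)=\mu$. *)

(* Defs.v *)
From mathcomp Require Import all_boot all_order all_algebra finmap multiset.
From mathcomp Require Import boolp classical_sets functions cardinality reals.

Set Implicit Arguments.
Unset Strict Implicit.
Unset Printing Implicit Defensive.

Import Order.TTheory GRing.Theory Num.Theory.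
Local Open Scope classical_set_scope.
Local Open Scope ring_scope.

(* Indices are shifted down by one: k : 'I_n stands for the integer k + 1 of
   [n] = {1, ..., n}, and i : 'I_n.+1 for the integer i + 1 of
   {1, ..., n + 1}. *)

Definition ico (n : nat) (i j : 'I_n.+1) : {set 'I_n} :=
  [set k : 'I_n | (i <= k < j)%N].

Definition is_interval (n : nat) (A : {set 'I_n}) : bool :=
  [exists i : 'I_n.+1, exists j : 'I_n.+1, (i < j)%N && (A == ico i j)].

Definition bar_interval (n : nat) : Type := {A : {set 'I_n} | is_interval A}.

Definition barcode (n : nat) : Type := {mset (bar_interval n)}%mset.

(* B I is the multiplicity of the interval I in the multiset B. *)
Definition betti_curve (n : nat) (B : barcode n) : {ffun 'I_n -> nat} :=
  [ffun k => (\sum_(I : bar_interval n | k \in val I) B I)%N].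

Definition Barc (n : nat) (beta : {ffun 'I_n -> nat}) : set (barcode n) :=
  [set B | betti_curve B = beta].

Definition basis_vec (R : realType) (n : nat) (i : 'I_n.+1) : 'rV[R]_n.+1 :=
  delta_mx 0 i.

Definition simple_root (R : realType) (n : nat) (i : 'I_n) : 'rV[R]_n.+1 :=
  basis_vec R (widen_ord (leqnSn n) i) - basis_vec R (lift ord0 i).

Definition root_index (n : nat) : Type :=
  {p : 'I_n.+1 * 'I_n.+1 | (p.1 < p.2)%N}.

Definition positive_root (R : realType) (n : nat) (r : root_index n) :
    'rV[R]_n.+1 :=
  basis_vec R (val r).1 - basis_vec R (val r).2.

Definition kostant_partitions (R : realType) (n : nat) (mu : 'rV[R]_n.+1) :
    set {ffun root_index n -> nat} :=
  [set c | \sum_(r : root_index n) positive_root R r *+ c r = mu].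

(* fset_set returns the empty set on infinite sets; this never happens here,
   by finite_kostant_partitions below. *)
Definition kostant (R : realType) (n : nat) (mu : 'rV[R]_n.+1) : nat :=
  #|` fset_set (kostant_partitions mu)|.

Lemma finite_kostant_partitions (R : realType) (n : nat) (mu : 'rV[R]_n.+1) :
  finite_set (kostant_partitions mu).
Proof.
have [->|/set0P[c0 c0mu]] := eqVneq (kostant_partitions mu) set0.
  exact: finite_set0.
pose ht (r : root_index n) := ((val r).2 - (val r).1)%N.
pose L (v : 'rV[R]_n.+1) : R := - \sum_(k < n.+1) v 0 k * k%:R.
have Lb i : \sum_(k < n.+1) basis_vec R i 0 k * k%:R = i%:R :> R.
  rewrite (bigD1 i) //= big1 => [|k ki]; first by rewrite mxE !eqxx mul1r addr0.
  by rewrite mxE (negbTE ki) andbF mul0r.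
have Lroot r : L (positive_root R r) = (ht r)%:R.
  rewrite /L; under eq_bigr do rewrite !mxE mulrBl.
  rewrite sumrB; have := Lb (val r).1; have := Lb (val r).2.
  under eq_bigr do rewrite mxE; move=> ->.
  under eq_bigr do rewrite mxE; move=> ->.
  by rewrite opprB /ht natrB // ltnW // (valP r).
have Lsum c : kostant_partitions mu c ->
    L mu = (\sum_(r : root_index n) c r * ht r)%N%:R.
  rewrite /kostant_partitions /= => <-; rewrite natr_sum /L.
  under [X in - X = _]eq_bigr do rewrite summxE mulr_suml.
  rewrite exchange_big /= -sumrN; apply: eq_bigr => r _.
  rewrite natrM -Lroot /L mulrN mulr_sumr; congr (- _).
  by apply: eq_bigr => k _; rewrite mulmxnE mulrnAl mulr_natl.
pose N := (\sum_(r : root_index n) c0 r * ht r)%N.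
pose f (g : {ffun root_index n -> 'I_N.+1}) : {ffun root_index n -> nat} :=
  [ffun r => nat_of_ord (g r)].
apply: (@sub_finite_set _ _ (f @` [set: {ffun root_index n -> 'I_N.+1}])).
  move=> c cmu; exists [ffun r => inord (c r)] => //.
  apply/ffunP => r; rewrite !ffunE inordK // ltnS.
  have /eqP : N%:R = (\sum_(r : root_index n) c r * ht r)%N%:R :> R.
    by rewrite -(Lsum _ cmu) (Lsum _ c0mu).
  rewrite eqr_nat => /eqP ->; rewrite (bigD1 r) //=.
  apply: (leq_trans _ (leq_addr _ _)); rewrite leq_pmulr // /ht subn_gt0.
  exact: valP r.
exact/finite_image/finite_finset.
Qed.

(* Main.v *)
Require Import Defs.
From mathcomp Require Import all_boot all_order all_algebra finmap multiset.
From mathcomp Require Import boolp classical_sets functions cardinality reals.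
From mathcomp Require Import zify.
Local Open Scope classical_set_scope.
Local Open Scope ring_scope.
Local Open Scope card_scope.

Import Order.TTheory GRing.Theory Num.Theory.

(* Sending the root e_i - e_j to the interval [i, j) is a bijection, and
   e_i - e_j is the sum of the simple roots alpha_k with k in [i, j).  Since the
   simple roots are linearly independent, a family of multiplicities of roots
   sums to mu exactly when the corresponding barcode has Betti curve beta. *)

Lemma positive_rootE (R : realType) (n : nat) (r : root_index n) :
  positive_root R r =
    \sum_(k in ico (val r).1 (val r).2) simple_root R k.
Proof.
case: r => -[i j] /= ij; rewrite /positive_root /=.
(* The minus sign makes [f j - f i] equal to [e_i - e_j]. Only arguments [m <= n] occur, so [inord]
   never takes its default value. *)
pose f m : 'rV[R]_n.+1 := - basis_vec R (inord m : 'I_n.+1).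
have := telescope_sumr f (ltnW ij).
rewrite /f !inord_val opprK addrC => <-.
rewrite (big_nat_widen _ _ n) -1?ltnS ?ltn_ord // big_geq_mkord.
apply: eq_big => [k|k _]; first by rewrite inE andbC.
rewrite opprK addrC /simple_root; congr (basis_vec R _ - basis_vec R _);
  by apply: val_inj; rewrite /= inordK // !ltnS // ltnW.
Qed.

Lemma sum_positive_root (R : realType) (n : nat) (c : root_index n -> nat) :
  \sum_r positive_root R r *+ c r =
    \sum_k simple_root R k
      *+ (\sum_(r : root_index n | k \in ico (val r).1 (val r).2) c r)%N.
Proof.
under eq_bigr do rewrite positive_rootE -sumrMnl.
rewrite (exchange_big_dep xpredT) //=.
by apply: eq_bigr => k _; rewrite sumrMnr.
Qed.

(* Summing the first k + 1 coordinates is a linear form dual to the k-th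
   simple root. *)
Lemma simple_root_free (R : realType) (n : nat) (a b : 'I_n -> nat) :
  \sum_k simple_root R k *+ a k = \sum_k simple_root R k *+ b k -> a =1 b.
Proof.
move=> ab k.
pose S (v : 'rV[R]_n.+1) := \sum_(l < n.+1 | (l <= k)%N) v 0 l.
have Sb i : S (basis_vec R i) = (i <= k)%N%:R.
  rewrite /S big_mkcond (bigD1 i) //= big1 => [|l li].
    by rewrite mxE !eqxx addr0; case: ifP.
  by rewrite mxE (negbTE li) andbF; case: ifP.
have Ss i : S (simple_root R i) = (i == k)%:R.
  have -> : S (simple_root R i) =
      S (basis_vec R (widen_ord (leqnSn n) i)) - S (basis_vec R (lift ord0 i)).
    by rewrite /S -sumrB; apply: eq_bigr => l _; rewrite !mxE.
  (* What remains is [[i <= k] - [i + 1 <= k]], which is 1 exactly at [i = k]. *)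
  rewrite !Sb /= /bump /= add1n -val_eqE /=.
  by case: ltngtP => // _; rewrite ?subr0 ?subrr.
have Ssum (c : 'I_n -> nat) : S (\sum_i simple_root R i *+ c i) = (c k)%:R.
  transitivity (\sum_i S (simple_root R i) *+ c i).
    rewrite /S; under eq_bigr do rewrite summxE.
    rewrite exchange_big; apply: eq_bigr => i _ /=.
    by rewrite -sumrMnl; apply: eq_bigr => l _; rewrite mulmxnE.
  rewrite (bigD1 k) //= big1 => [|i ik]; first by rewrite Ss eqxx addr0.
  by rewrite Ss (negbTE ik) mul0rn.
by apply/eqP; rewrite -(eqr_nat R) -!Ssum ab.
Qed.

Lemma kostant_partitionsE (R : realType) (n : nat) (beta : 'I_n -> nat) :
  kostant_partitions (\sum_k simple_root R k *+ beta k) =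
    [set c | forall k, (\sum_(r : root_index n
                            | k \in ico (val r).1 (val r).2) c r)%N = beta k].
Proof.
apply/seteqP; split => c; rewrite /kostant_partitions /= sum_positive_root.
  exact: simple_root_free.
by move=> cb; apply: eq_bigr => k _; rewrite cb.
Qed.

Lemma is_interval_ico (n : nat) (i j : 'I_n.+1) :
  (i < j)%N -> is_interval (ico i j).
Proof.
by move=> ij; apply/existsP; exists i; apply/existsP; exists j; rewrite ij /=.
Qed.

Definition bar_of_root (n : nat) (r : root_index n) : bar_interval n :=
  exist _ (ico (val r).1 (val r).2) (is_interval_ico _ _ _ (valP r)).

(** A nonempty interval determines its endpoints by its least and greatest elements; all empty ones
    coincide, whence the strict inequalities. *)
Lemma ico_inj (n : nat) (i j i' j' : 'I_n.+1) :
  (i < j)%N -> (i' < j')%N -> ico i j = ico i' j' -> i = i' /\ j = j'.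
Proof.
move=> ij ij' /setP e.
have E m : (m < n)%N -> (i <= m < j)%N = (i' <= m < j')%N.
  by move=> mn; have := e (Ordinal mn); rewrite !inE.
(* Membership is compared at the first and last elements of both intervals: [i], [i'], [j - 1] and
   [j' - 1], all below [n]. *)
have := ltn_ord j; have := ltn_ord j'; rewrite !ltnS => jn' jn.
have ei := E i (leq_trans ij jn); have ei' := E i' (leq_trans ij' jn').
have ej : (i <= j.-1 < j)%N = (i' <= j.-1 < j')%N.
  by apply: E; case: (nat_of_ord j) ij jn.
have ej' : (i <= j'.-1 < j)%N = (i' <= j'.-1 < j')%N.
  by apply: E; case: (nat_of_ord j') ij' jn'.
split; apply: val_inj => /=; lia.
Qed.

Lemma bar_of_root_bij (n : nat) : bijective (@bar_of_root n).
Proof.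
have inj : injective (@bar_of_root n).
  move=> [[i j] ij] [[i' j'] ij'] /(congr1 val) /= /ico_inj.
  by case=> // ? ?; apply: val_inj; congr (_, _).
have /choice[g gK] : forall I : bar_interval n, exists r, bar_of_root n r = I.
  move=> [A /[dup] /existsP[i /existsP[j /andP[ij /eqP->]]] Aint].
  by exists (exist _ (i, j) ij); apply: val_inj.
by exists g => // r; apply: inj; rewrite gK.
Qed.

Theorem theoremA (R : realType) (n : nat) (hn : (0 < n)%N)
    (beta : {ffun 'I_n -> nat}) :
  Barc beta #= `I_(kostant (\sum_(i < n) simple_root R i *+ beta i)).
Proof.
set mu := \sum_(i < n) _.
have [m Km] := finite_kostant_partitions mu.
have [g bK gK] := bar_of_root_bij n.
pose f (B : barcode n) : {ffun root_index n -> nat} :=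
  [ffun r => B (bar_of_root _ r)].
have finj : injective f.
  move=> B B' /ffunP e; apply/msetP => I.
  by have := e (g I); rewrite !ffunE gK.
rewrite /kostant (card_fset_set Km); apply: card_eq_trans Km.
(* As [f] is injective, [Barc beta] has as many elements as its image. *)
suff -> : kostant_partitions mu = f @` Barc beta.
  by rewrite card_eq_sym; apply: inj_card_eq => B B' _ _; apply: finj.
rewrite kostant_partitionsE.
have fE (B : barcode n) k :
  (\sum_(r | k \in ico (val r).1 (val r).2) f B r)%N = betti_curve B k.
  rewrite ffunE (reindex _ (onW_bij _ (bar_of_root_bij n))) /=.
  by apply: eq_bigr => r _; rewrite ffunE.
apply/seteqP; split => [c cb|_ [B Bb <-] k] /=; last by rewrite fE Bb.
pose B : barcode n :=
    [fsfun I in [fset I in {: bar_interval n}]%fset => c (g I)].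
have Bc : f B = c.
  by apply/ffunP => r; rewrite ffunE fsfunE inE /= bK.
by exists B => //; apply/ffunP => k; rewrite -fE Bc cb.
Qed.
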